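(* Let $G,H$ be finite groups, $\omega\in Z^3(G,U(1))$ and $\eta\in Z^3(H,U(1))$. If there exists a rigid isomorphism $\mathcal D^\omega(G)\to\mathcal D^\eta(H)$, then $G\cong H$. Furthermore, every rigid isomorphism $\mathcal D^\omega(G)\to\mathcal D^\eta(H)$ is a morphism of quasi-Hopf algebras.
   Context: All algebras are over $\mathbb C$. For a finite group $G$, $\mathbb CG$ is the group Hopf algebra and $\mathbb C^G$ its dual with dual basis $(e_g)$, unit $\varepsilon=\sum_ge_g$, counit $\mathrm{ev}_1(e_g)=\delta_{g,1}$. $Z^3(G,U(1))$ is the set of normalized 3-cocycles: functions $\omega\colon G^3\to U(1)$ with $\omega(g,1,h)=1$ and $\omega(a,b,c)\omega(a,bc,d)\omega(b,c,d)=\omega(ab,c,d)\omega(a,b,cd)$. Put $$\theta_g(x,y)=\frac{\omega(g,x,y)\,\omega(x,y,(xy)^{-1}gxy)}{\omega(x,x^{-1}gx,y)},\qquad \gamma_x(g,h)=\frac{\omega(g,h,x)\,\omega(x,x^{-1}gx,x^{-1}hx)}{\omega(g,x,x^{-1}hx)}.$$ The twisted double $\mathcal D^\omega(G)$ is the quasi-Hopf algebra with underlying space $\mathbb C^G\otimes\mathbb CG$, basis $e_g\#x$, multiplication $(e_g\#x)(e_h\#y)=\delta_{g,xhx^{-1}}\theta_g(x,y)e_g\#xy$, unit $\varepsilon\#1$, comultiplication $\Delta(e_g\#x)=\sum_{t}\gamma_x(gt^{-1},t)e_{gt^{-1}}\#x\otimes e_t\#x$, counit $\mathrm{ev}_1\otimes\varepsilon$,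 coassociator $\phi=\sum_{a,b,c}\omega(a,b,c)^{-1}e_a\#1\otimes e_b\#1\otimes e_c\#1$, antipode $S(e_g\#x)=\theta_{g^{-1}}(x,x^{-1})^{-1}\gamma_x(g,g^{-1})^{-1}e_{x^{-1}g^{-1}x}\#x^{-1}$, and elements $\alpha=1$, $\beta=\sum_g\omega(g,g^{-1},g)e_g\#1$. $\mathcal D(G)$ denotes $\mathcal D^\omega(G)$ with $\omega\equiv1$, an ordinary Hopf algebra on the same underlying vector space. A morphism of quasi-bialgebras is a unital algebra morphism that respects comultiplications and counits and maps coassociator to coassociator; it is a morphism of quasi-Hopf algebras if it moreover commutes with the antipodes and preserves the elements $\alpha$ and $\beta$. A rigid isomorphism $\mathcal D^\omega(G)\to\mathcal D^\eta(H)$ is a bijective morphism of quasi-bialgebras $\mathcal D^\omega(G)\to\mathcal D^\eta(H)$ which, as a linear map $\mathbb C^G\otimes\mathbb CG\to\mathbb C^H\otimes\mathbb CH$, is also a morphism of Hopf algebras $\mathcal D(G)\to\mathcal D(H)$. *)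

(* Defs.v *)
From HB Require Import structures.
From mathcomp Require Import all_boot all_order all_algebra all_fingroup.
From mathcomp Require Import reals complex.
Set Implicit Arguments.
Unset Strict Implicit.
Unset Printing Implicit Defensive.
Import GRing.Theory Num.Theory.
Local Open Scope ring_scope.

(* A finite-dimensional space is represented by coordinates on a finite basis
   I; the tensor product of the spaces on I and J is then the space on I * J. *)
Notation coord_space C I := {ffun I -> C^o}.

Definition basisv (C : fieldType) (I : finType) (i : I) : coord_space C I :=
  [ffun j => (j == i)%:R].

Definition lin_ext (C : fieldType) (I : finType) (W : lmodType C)
  (F : I -> W) (u : coord_space C I) : W := \sum_i u i *: F i.

Definition tens (C : fieldType) (I J : finType)
  (u : coord_space C I) (v : coord_space C J) : coord_space C (I * J)%type :=
  [ffun p => u p.1 * v p.2].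

Definition tens_map (C : fieldType) (I I' J J' : finType)
  (f : coord_space C I -> coord_space C J)
  (f' : coord_space C I' -> coord_space C J') :
  coord_space C (I * I')%type -> coord_space C (J * J')%type :=
  lin_ext (fun p => tens (f (basisv C p.1)) (f' (basisv C p.2))).

(* Operations only: the morphism conditions below do not refer to the
   quasi-Hopf axioms. *)
Record quasi_hopf_data (C : fieldType) (I : finType) := QuasiHopfData {
  qh_mul : coord_space C I -> coord_space C I -> coord_space C I;
  qh_one : coord_space C I;
  qh_comul : coord_space C I -> coord_space C (I * I)%type;
  qh_counit : coord_space C I -> C;
  qh_coassociator : coord_space C (I * I * I)%type;
  qh_antipode : coord_space C I -> coord_space C I;
  qh_alpha : coord_space C I;
  qh_beta : coord_space C I
}.

Definition algebra_morphism (C : fieldType) (I J : finType)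
  (A : quasi_hopf_data C I) (B : quasi_hopf_data C J)
  (f : {linear coord_space C I -> coord_space C J}) : Prop :=
  f (qh_one A) = qh_one B /\
  forall u v, f (qh_mul A u v) = qh_mul B (f u) (f v).

Definition coalgebra_morphism (C : fieldType) (I J : finType)
  (A : quasi_hopf_data C I) (B : quasi_hopf_data C J)
  (f : {linear coord_space C I -> coord_space C J}) : Prop :=
  (forall u, qh_comul B (f u) = tens_map f f (qh_comul A u)) /\
  (forall u, qh_counit B (f u) = qh_counit A u).

Definition antipode_compatible (C : fieldType) (I J : finType)
  (A : quasi_hopf_data C I) (B : quasi_hopf_data C J)
  (f : {linear coord_space C I -> coord_space C J}) : Prop :=
  forall u, f (qh_antipode A u) = qh_antipode B (f u).

Definition quasi_bialgebra_morphism (C : fieldType) (I J : finType)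
  (A : quasi_hopf_data C I) (B : quasi_hopf_data C J)
  (f : {linear coord_space C I -> coord_space C J}) : Prop :=
  [/\ algebra_morphism A B f, coalgebra_morphism A B f &
      tens_map (tens_map f f) f (qh_coassociator A) = qh_coassociator B].

Definition quasi_hopf_morphism (C : fieldType) (I J : finType)
  (A : quasi_hopf_data C I) (B : quasi_hopf_data C J)
  (f : {linear coord_space C I -> coord_space C J}) : Prop :=
  [/\ quasi_bialgebra_morphism A B f, antipode_compatible A B f,
      f (qh_alpha A) = qh_alpha B & f (qh_beta A) = qh_beta B].

Definition hopf_morphism (C : fieldType) (I J : finType)
  (A : quasi_hopf_data C I) (B : quasi_hopf_data C J)
  (f : {linear coord_space C I -> coord_space C J}) : Prop :=
  [/\ algebra_morphism A B f, coalgebra_morphism A B f &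
      antipode_compatible A B f].

Definition normalized_3cocycle (C : numFieldType) (gT : finGroupType)
  (w : gT -> gT -> gT -> C) : Prop :=
  [/\ forall a b c, `|w a b c| = 1,
      forall g h, w g 1%g h = 1 &
      forall a b c d,
        w a b c * w a (b * c)%g d * w b c d =
        w (a * b)%g c d * w a b (c * d)%g].

(* In MathComp, g ^ x = x^-1 g x for elements of a group. *)
Definition theta (C : fieldType) (gT : finGroupType)
  (w : gT -> gT -> gT -> C) (g x y : gT) : C :=
  w g x y * w x y (g ^ (x * y))%g / w x (g ^ x)%g y.

Definition gamma (C : fieldType) (gT : finGroupType)
  (w : gT -> gT -> gT -> C) (x g h : gT) : C :=
  w g h x * w x (g ^ x)%g (h ^ x)%g / w g x (h ^ x)%g.

(* The basis vector e_g # x is basisv C (g, x). *)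
Definition twisted_double (C : fieldType) (gT : finGroupType)
  (w : gT -> gT -> gT -> C) : quasi_hopf_data C (gT * gT)%type :=
  {| qh_mul u v :=
       lin_ext (fun i : gT * gT => let: (g, x) := i in
         lin_ext (fun j : gT * gT => let: (h, y) := j in
           ((g == h ^ x^-1)%g%:R * theta w g x y) *: basisv C (g, (x * y)%g))
         v) u;
     qh_one := \sum_(g : gT) basisv C (g, 1%g);
     qh_comul :=
       lin_ext (fun i : gT * gT => let: (g, x) := i in
         \sum_(t : gT) gamma w x (g * t^-1)%g t *:
           tens (basisv C ((g * t^-1)%g, x)) (basisv C (t, x)));
     qh_counit :=
       lin_ext (fun i : gT * gT => let: (g, _) := i in (g == 1%g)%:R : C^o);
     qh_coassociator :=
       \sum_(a : gT) \sum_(b : gT) \sum_(c : gT) (w a b c)^-1 *: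
         tens (tens (basisv C (a, 1%g)) (basisv C (b, 1%g)))
              (basisv C (c, 1%g));
     qh_antipode :=
       lin_ext (fun i : gT * gT => let: (g, x) := i in
         ((theta w g^-1%g x x^-1%g)^-1 * (gamma w x g g^-1%g)^-1) *:
           basisv C ((g^-1 ^ x)%g, x^-1%g));
     qh_alpha := \sum_(g : gT) basisv C (g, 1%g);
     qh_beta := \sum_(g : gT) w g g^-1%g g *: basisv C (g, 1%g) |}.

Definition drinfeld_double (C : fieldType) (gT : finGroupType) :
  quasi_hopf_data C (gT * gT)%type :=
  twisted_double (fun _ _ _ : gT => 1 : C).

Definition rigid_isomorphism (C : fieldType) (gT hT : finGroupType)
  (w : gT -> gT -> gT -> C) (eta : hT -> hT -> hT -> C)
  (f : {linear coord_space C (gT * gT)%type ->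
               coord_space C (hT * hT)%type}) : Prop :=
  [/\ bijective f,
      quasi_bialgebra_morphism (twisted_double w) (twisted_double eta) f &
      hopf_morphism (drinfeld_double C gT) (drinfeld_double C hT) f].

(* Main.v *)
Require Import Defs.
From HB Require Import structures.
From mathcomp Require Import all_boot all_order all_algebra all_fingroup.
From mathcomp Require Import reals complex.
From mathcomp Require Import cyclic abelian separable cyclotomic.
Set Implicit Arguments.
Unset Strict Implicit.
Unset Printing Implicit Defensive.
Import GRing.Theory Num.Theory.

(** Write [S_0], [*_0], [Delta_0] for the untwisted operations.  A rigid
    isomorphism commutes with the twisted and the untwisted structure at once,
    hence with every operator built from both.  Convolving the two structures
    produces the diagonal operators multiplying [e_g # x] by
    [theta_{g^-1}(x, x^-1)] and by [gamma_x(g, g^-1)]; these are exactly the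
    factors by which the twisted antipode differs from [S_0].  Likewise
    [m_0 (id (x) S_0 (x) id)] sends the coassociator to the inverse of [beta],
    and [alpha] is the unit.

    For the groups, the group-like elements of [D(G)] form the group [G^ * G],
    where [G^] is the character group, so [G^ * G] and [H^ * H] are isomorphic.
    Let [h(K, T)] count the homomorphisms from [K] to [T] that kill a given
    subset of [K].  Dualizing, and as the abelian group [G^] is isomorphic to
    its own dual, [h(K, G^)^2 = h(K, H^)^2]; hence [h(K, G^) = h(K, H^)], and
    then [h(K, G) = h(K, H)].  By Lovasz's argument these numbers determine the
    number of injective homomorphisms from [K], so [G] embeds in [H] and
    conversely. *)

(** * Homomorphism counts and character groups *)

Section GroupCancellation.

Local Open Scope group_scope.

Implicit Types gT hT kT : finGroupType.

Definition group_iso (gT hT : finGroupType) :=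
  exists2 f : gT -> hT, bijective f & {morph f : x y / x * y}.

Lemma group_iso_sym gT hT : group_iso gT hT -> group_iso hT gT.
Proof.
move=> [f [g fK gK] fM]; exists g; first by exists f.
by move=> x y; rewrite -[x in LHS]gK -[y in LHS]gK -fM fK.
Qed.

Lemma group_iso_trans gT hT kT :
  group_iso gT hT -> group_iso hT kT -> group_iso gT kT.
Proof.
move=> [f f_bij fM] [g g_bij gM]; exists (g \o f); first exact: bij_comp.
by move=> x y /=; rewrite fM gM.
Qed.

Lemma group_iso_prod gT gT' hT hT' :
  group_iso gT gT' -> group_iso hT hT' ->
  group_iso (gT * hT)%type (gT' * hT')%type.
Proof.
move=> [f [f' fK f'K] fM] [g [g' gK g'K] gM].
exists (fun p => (f p.1, g p.2)).
  by exists (fun p => (f' p.1, g' p.2)) => -[x y] /=; rewrite ?fK ?gK ?f'K ?g'K.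
by move=> [x y] [x' y'] /=; rewrite fM gM.
Qed.

Definition is_hom (gT hT : finGroupType) (f : {ffun gT -> hT}) :=
  [forall x, forall y, f (x * y) == f x * f y].

Lemma is_homP (gT hT : finGroupType) (f : {ffun gT -> hT}) :
  reflect {morph f : x y / x * y} (is_hom f).
Proof.
apply: (iffP forallP) => [fM x y|fM x]; first by apply/eqP/(forallP (fM x)).
by apply/forallP => y; rewrite fM.
Qed.

Lemma morph1_fun (gT hT : finGroupType) (f : gT -> hT) :
  {morph f : x y / x * y} -> f 1 = 1.
Proof. by move=> fM; apply: (mulgI (f 1)); rewrite -fM !mulg1. Qed.

(** * Counting homomorphisms by their kernels *)

Section HomCounting.

Variable kT : finGroupType.
Implicit Types S : {set kT}.

(** These correspond to the homomorphisms from the quotient of [kT] by the normal closure of [S]; a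
    bare subset [S] spares the quotient types. *)
Definition homs S gT :=
  [set f : {ffun kT -> gT} | is_hom f & [forall x in S, f x == 1]].

Lemma homsP S gT (f : {ffun kT -> gT}) :
  reflect ({morph f : x y / x * y} /\ {in S, forall x, f x = 1})
          (f \in homs S gT).
Proof.
rewrite inE; apply: (iffP andP) => -[/is_homP fM fS]; split=> //.
  by move=> x xS; apply/eqP/(forall_inP fS).
by apply/forall_inP => x xS; rewrite fS.
Qed.

Lemma homs_gt0 S gT : 0 < #|homs S gT|.
Proof.
apply/card_gt0P; exists [ffun => 1]; apply/homsP.
by split=> [x y|x _]; rewrite !ffunE ?mulg1.
Qed.

Lemma card_homs_iso S gT hT : group_iso gT hT -> #|homs S gT| = #|homs S hT|.
Proof.
have le gT' hT' : group_iso gT' hT' -> #|homs S gT'| <= #|homs S hT'|.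
  move=> [f f_bij fM]; pose F (h : {ffun kT -> gT'}) := [ffun x => f (h x)].
  have F_inj : injective F.
    move=> h h' /ffunP eqF; apply/ffunP => x; apply: (bij_inj f_bij).
    by have := eqF x; rewrite !ffunE.
  rewrite -(card_imset _ F_inj); apply/subset_leq_card/subsetP => h'.
  move=> /imsetP[h /homsP[hM hS] ->]; apply/homsP.
  split=> [x y|x xS]; first by rewrite !ffunE hM fM.
  by rewrite ffunE hS //; exact: morph1_fun.
move=> gh; apply/eqP; rewrite eqn_leq !le //; exact: group_iso_sym.
Qed.

Lemma card_homs_prod S gT hT :
  #|homs S (gT * hT)%type| = (#|homs S gT| * #|homs S hT|)%N.
Proof.
pose F (p : {ffun kT -> gT} * {ffun kT -> hT}) : {ffun kT -> gT * hT} :=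
  [ffun x => (p.1 x, p.2 x)].
have F_inj : injective F.
  move=> [h1 h2] [h1' h2'] /ffunP eqF; congr (_, _); apply/ffunP => x;
  by have := eqF x; rewrite !ffunE => -[].
rewrite -cardsX -(card_imset _ F_inj); congr #|pred_of_set _|; apply/setP => h.
apply/homsP/imsetP => [[hM hS]|[[h1 h2]]].
  exists ([ffun x => (h x).1], [ffun x => (h x).2]).
    rewrite in_setX; apply/andP; split; apply/homsP;
    split=> [x y|x xS]; rewrite !ffunE ?hM //; by rewrite hS.
  by apply/ffunP => x; rewrite !ffunE -surjective_pairing.
rewrite in_setX => /andP[/homsP[h1M h1S] /homsP[h2M h2S]] ->.
split=> [x y|x xS]; rewrite !ffunE /=; first by rewrite h1M h2M.
by rewrite h1S ?h2S.
Qed.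

Definition homs_ker S gT :=
  [set f : {ffun kT -> gT} | is_hom f & [set x | f x == 1] == S].

(** Sort the homomorphisms by their exact kernel [R]; a set [R] that is not a normal subgroup
    contributes 0. *)
Lemma card_homs_ker S gT :
  #|homs S gT| = (\sum_(R : {set kT} | S \subset R) #|homs_ker R gT|)%N.
Proof.
rewrite -sum1_card (partition_big
  (fun f : {ffun kT -> gT} => [set x | f x == 1])
  (fun R : {set kT} => S \subset R)) /= => [|f /homsP[_ fS]].
  apply: eq_bigr => R SR; rewrite -sum1_card; apply: eq_bigl => f.
  rewrite !inE -andbA; congr (_ && _); apply: andb_idl => /eqP kerf.
  by apply/forall_inP => x /(subsetP SR); rewrite -kerf inE.
by apply/subsetP => x xS; rewrite inE fS.
Qed.

(** Inversion of [card_homs_ker]: apart from [R = S], every summand has [R] strictly larger than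
    [S], so induction on the size of the complement of [S] cancels all the others. *)
Lemma card_homs_ker_eq gT hT :
  (forall S, #|homs S gT| = #|homs S hT|) ->
  forall S, #|homs_ker S gT| = #|homs_ker S hT|.
Proof.
move=> eq_homs S; have [m] := ubnP #|~: S|; elim: m S => // m IHm S leSm.
have := eq_homs S; rewrite !card_homs_ker (bigD1 S) //= [RHS](bigD1 S) //=.
rewrite [X in (_ + X)%N](eq_bigr (fun R => #|homs_ker R hT|)).
  exact: addIn.
move=> R /andP[SR neqRS]; apply: IHm; apply: (@leq_trans #|~: S|) => //.
by apply: proper_card; rewrite properC properEneq eq_sym neqRS.
Qed.

(** The identity of [kT] has kernel [[set 1]], so the equal count for [hT] is positive too. *)
Lemma exists_injective_hom hT :
  (forall S, #|homs S kT| = #|homs S hT|) ->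
  exists2 f : kT -> hT, injective f & {morph f : x y / x * y}.
Proof.
move=> /card_homs_ker_eq/(_ [set 1]) eq_card.
have : 0 < #|homs_ker [set 1] kT|.
  apply/card_gt0P; exists [ffun x => x]; rewrite inE; apply/andP; split.
    by apply/is_homP => x y; rewrite !ffunE.
  by apply/eqP/setP => x; rewrite !inE ffunE.
rewrite eq_card => /card_gt0P[f]; rewrite inE.
move=> /andP[/is_homP fM /eqP/setP kerf].
exists f => // x y fxy; apply: (mulIg y^-1); rewrite mulgV; apply/set1P.
by rewrite -kerf inE fM fxy -fM mulgV morph1_fun.
Qed.

End HomCounting.

(** Embeddings in both directions between finite groups force equal orders, so either embedding is
    bijective. *)
Lemma group_iso_from_card_homs (gT hT : finGroupType) :
  (forall (kT : finGroupType) (S : {set kT}), #|homs S gT| = #|homs S hT|) ->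
  group_iso gT hT.
Proof.
move=> eq_homs; have [f f_inj fM] := exists_injective_hom (eq_homs gT).
have [g g_inj _] := exists_injective_hom (fun S => esym (eq_homs hT S)).
by exists f => //; apply: inj_card_bij => //; apply: leq_card g_inj.
Qed.

(** * Duality of finite abelian groups and cancellation *)

Section Dual.

Variable n : nat.

(* Characters of exponent dividing [n.+1]: the additive cyclic group ['I_n.+1]
   stands for the [n.+1]-th roots of unity. *)
Definition dual (gT : finGroupType) := {f : {ffun gT -> 'I_n.+1} | is_hom f}.
HB.instance Definition _ gT := Finite.on (dual gT).

Section DualGroup.

Variable gT : finGroupType.
Implicit Types f : dual gT.

Definition dual_fun f : gT -> 'I_n.+1 := val f.
Coercion dual_fun : dual >-> Funclass.

Lemma dual_morph f : {morph f : x y / x * y}.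
Proof. exact/is_homP/(valP f). Qed.

Lemma dual_eq f f' : f =1 f' -> f = f'.
Proof. by move=> eqf; apply: val_inj; apply/ffunP. Qed.

Lemma mk_dual_proof (f : gT -> 'I_n.+1) :
  {morph f : x y / x * y} -> is_hom [ffun x => f x].
Proof. by move=> fM; apply/is_homP => x y; rewrite !ffunE fM. Qed.

Definition mk_dual (f : gT -> 'I_n.+1) fM : dual gT :=
  Sub [ffun x => f x] (@mk_dual_proof f fM).

Lemma mk_dualE (f : gT -> 'I_n.+1) fM x : mk_dual (f := f) fM x = f x.
Proof. by rewrite /dual_fun /mk_dual SubK ffunE. Qed.

Lemma ordinal_mulgC (x y : 'I_n.+1) : x * y = y * x.
Proof. exact: Zp_addC. Qed.

Lemma dual_one_morph : {morph (fun _ : gT => 1 : 'I_n.+1) : x y / x * y}.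
Proof. by move=> x y; rewrite mulg1. Qed.

Lemma dual_mul_morph f f' : {morph (fun x => f x * f' x) : x y / x * y}.
Proof.
move=> x y /=; rewrite !dual_morph -!mulgA; congr (_ * _).
by rewrite !mulgA; congr (_ * _); rewrite ordinal_mulgC.
Qed.

Lemma dual_inv_morph f : {morph (fun x => (f x)^-1) : x y / x * y}.
Proof. by move=> x y /=; rewrite dual_morph invMg ordinal_mulgC. Qed.

Definition dual_one := mk_dual dual_one_morph.
Definition dual_mul f f' := mk_dual (dual_mul_morph f f').
Definition dual_inv f := mk_dual (dual_inv_morph f).

Lemma dual_mulA : associative dual_mul.
Proof. by move=> f f' f''; apply: dual_eq => x; rewrite !mk_dualE mulgA. Qed.

Lemma dual_mul1 : left_id dual_one dual_mul.
Proof. by move=> f; apply: dual_eq => x; rewrite !mk_dualE mul1g. Qed.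

Lemma dual_mulV : left_inverse dual_one dual_inv dual_mul.
Proof. by move=> f; apply: dual_eq => x; rewrite !mk_dualE mulVg. Qed.

End DualGroup.

HB.instance Definition _ gT := Finite_isGroup.Build (dual gT)
  (@dual_mulA gT) (@dual_mul1 gT) (@dual_mulV gT).

Lemma dualM gT (f f' : dual gT) x : dual_fun (f * f') x = f x * f' x.
Proof. exact: mk_dualE. Qed.

Lemma dual_abelian gT (f f' : dual gT) : f * f' = f' * f.
Proof. by apply: dual_eq => x; rewrite !dualM ordinal_mulgC. Qed.

Lemma dual_exponent gT (f : dual gT) : f ^+ n.+1 = 1.
Proof.
apply: dual_eq => x; rewrite [RHS]mk_dualE.
have expE m : dual_fun (f ^+ m) x = f x ^+ m.
  elim: m => [|m IHm]; first exact: mk_dualE.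
  by rewrite !expgS dualM IHm.
rewrite expE; have := expg_cardG (in_setT (f x)).
by rewrite cardsT card_ord.
Qed.

Lemma dual_iso gT hT : group_iso gT hT -> group_iso (dual gT) (dual hT).
Proof.
move=> [f [g fK gK] fM].
have gM : {morph g : x y / x * y}.
  by move=> x y; rewrite -[x in LHS]gK -[y in LHS]gK -fM fK.
have pullM (kT kT' : finGroupType) (h : kT' -> kT)
    (hM : {morph h : x y / x * y}) (u : dual kT) :
  {morph u \o h : x y / x * y} by move=> x y /=; rewrite hM dual_morph.
exists (fun u => mk_dual (pullM _ _ _ gM u)).
  exists (fun u => mk_dual (pullM _ _ _ fM u)) => u; apply: dual_eq => x;
  by rewrite !mk_dualE /= !mk_dualE /= ?fK ?gK.
by move=> u v; apply: dual_eq => x; rewrite dualM !mk_dualE /= dualM.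
Qed.

(** A character of a product is the pair of its restrictions to the factors; pairs recombine because
    the target is commutative. *)
Lemma dual_prod gT hT :
  group_iso (dual (gT * hT)%type) (dual gT * dual hT)%type.
Proof.
have lM (u : dual (gT * hT)%type) : {morph (fun x => u (x, 1)) : x y / x * y}.
  by move=> x y; rewrite -dual_morph; congr (u (_, _)); rewrite mulg1.
have rM (u : dual (gT * hT)%type) : {morph (fun x => u (1, x)) : x y / x * y}.
  by move=> x y; rewrite -dual_morph; congr (u (_, _)); rewrite mulg1.
have pM (p : dual gT * dual hT) :
    {morph (fun x : gT * hT => p.1 x.1 * p.2 x.2) : x y / x * y}.
  move=> [x x'] [y y'] /=; rewrite !dual_morph -!mulgA; congr (_ * _).
  by rewrite !mulgA; congr (_ * _); rewrite ordinal_mulgC.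
exists (fun u => (mk_dual (lM u), mk_dual (rM u))).
  exists (fun p => mk_dual (pM p)) => [u|[u v]].
    apply: dual_eq => -[x y]; rewrite !mk_dualE -dual_morph.
    by congr (u (_, _)); rewrite ?mulg1 ?mul1g.
  congr (_, _); apply: dual_eq => x; rewrite !mk_dualE /=;
  by rewrite (morph1_fun (@dual_morph _ _)) ?mulg1 ?mul1g.
by move=> u v; congr (_, _); apply: dual_eq => x; rewrite !(dualM, mk_dualE).
Qed.

(** With discrete logarithms to base [x], the element [y] goes to the character sending [z] to
    [e * log z * log y] modulo [n.+1]. The inverse reads off the value of a character at [x]. *)
Lemma dual_cyclic gT (x : gT) :
  [set: gT] = <[x]> -> x ^+ n.+1 = 1 -> group_iso gT (dual gT).
Proof.
move=> gen_x xN; have dvd_N : #[x] %| n.+1 by rewrite order_dvdn xN.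
(* Multiplication by [e] identifies the integers modulo [#[x]] with the multiples of [e] modulo
   [n.+1]. *)
set e := n.+1 %/ #[x]; have eN : (e * #[x])%N = n.+1 by rewrite divnK.
have e_gt0 : 0 < e by have := ltn0Sn n; rewrite -eN muln_gt0 => /andP[].
have log_ex (y : gT) : exists i, y == x ^+ i.
  by have /cycleP[i ->] : y \in <[x]>; [rewrite -gen_x inE | exists i].
pose log y := xchoose (log_ex y); pose u i : 'I_n.+1 := inZp (e * i).
have logK (y : gT) : y = x ^+ log y by apply/eqP/(xchooseP (log_ex y)).
have uD i j : u (i + j)%N = u i * u j.
  by apply: val_inj; rewrite /= mulnDr modnDm.
have u_eq i j : (u i == u j) = (x ^+ i == x ^+ j).
  by rewrite eq_expg_mod_order -val_eqE /= -eN -!muln_modr eqn_pmul2l.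
have logM k (y z : gT) : u (log (y * z)%g * k)%N =
    u (log y * k)%N * u (log z * k)%N.
  rewrite -uD -mulnDl; apply/eqP; rewrite u_eq !expgM -logK.
  by rewrite expgD -!logK.
have chM (y : gT) : {morph (fun z => u (log z * log y)%N) : a b / a * b}.
  by move=> a b; rewrite logM.
exists (fun y => mk_dual (chM y)).
  exists (fun f : dual gT => x ^+ (f x %/ e)) => [y|f].
    rewrite mk_dualE /u /= -[X in _ %% X]eN -muln_modr mulKn //.
    by rewrite expg_mod_order expgM -!logK.
  have fX (y : gT) m : f (y ^+ m) = f y ^+ m.
    elim: m => [|m IHm]; first exact/morph1_fun/dual_morph.
    by rewrite !expgS dual_morph IHm.
  (* Since [x ^+ #[x]] is trivial, [n.+1 = e * #[x]] divides [f x * #[x]]. *)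
  have dvd_f : e %| f x.
    rewrite -(@dvdn_pmul2r #[x]) ?order_gt0 // eN.
    have := fX x #[x]; rewrite expg_order Zp_expg.
    rewrite (morph1_fun (@dual_morph _ f)).
    by move/(congr1 val) => /= f0; rewrite /dvdn -f0.
  have uX k m : u k ^+ m = u (m * k)%N.
    by rewrite Zp_expg; apply: val_inj; rewrite /= modnMml -mulnA (mulnC k).
  apply: dual_eq => y; rewrite mk_dualE [in RHS](logK y) fX.
  have fxE : f x = u (f x %/ e).
    by apply: val_inj; rewrite /= mulnC divnK // modn_small.
  rewrite [in RHS]fxE uX; apply/eqP.
  by rewrite u_eq !(mulnC (log y)) !expgM -logK.
move=> y z; apply: dual_eq => a; rewrite dualM !mk_dualE.
by rewrite mulnC logM ![(log a * _)%N]mulnC.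
Qed.

(** Turns an internal direct product into a product of group types, on which [dual] is defined.
    Uniqueness of the factorization gives injectivity, and the orders agree. *)
Lemma subg_dprod gT (A B G : {group gT}) :
  A \x B = G -> group_iso (subg_of A * subg_of B)%type (subg_of G).
Proof.
move=> defG; have [_ mulAB cAB tiAB] := dprodP defG.
have mulG (p : subg_of A * subg_of B) : sgval p.1 * sgval p.2 \in G.
  by rewrite -mulAB mem_mulg ?subgP.
exists (fun p => subg G (sgval p.1 * sgval p.2)).
  apply: inj_card_bij => [[a b] [a' b']|].
    move=> /(congr1 sgval); rewrite !subgK ?(mulG (_, _)) //= => eq_ab.
    have [y [z [_ _ _ uniq_yz]]] := mem_dprod defG (mulG (a, b)).
    have [ay bz] := uniq_yz _ _ (subgP a) (subgP b) (erefl _).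
    have [a'y b'z] := uniq_yz _ _ (subgP a') (subgP b') eq_ab.
    by congr (_, _); apply: val_inj; rewrite /= ?ay ?bz.
  rewrite card_prod -![#|subg_of _|]cardsT -!(card_isog (isog_subg _)).
  by rewrite (dprod_card defG).
move=> [a b] [a' b'] /=; rewrite -subgM ?(mulG (_, _)) //=.
rewrite !mulgA; congr (subg G (_ * _)); rewrite -!mulgA; congr (_ * _).
exact/esym/((centsP cAB) _ (subgP b) _ (subgP a')).
Qed.

(** By the structure theorem the group is a direct product of cyclic groups. Each is self-dual
    because its order divides [n.+1], and [dual] respects products. *)
Lemma dual_abelian_iso gT :
  abelian [set: gT] -> (forall x : gT, x ^+ n.+1 = 1) -> group_iso gT (dual gT).
Proof.
move=> abT expT.
have cyc (x : gT) : group_iso (subg_of <[x]>) (dual (subg_of <[x]>)).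
  apply: (@dual_cyclic _ (subg <[x]> x)).
    by rewrite -morphim_cycle ?cycle_id // im_subg.
  by rewrite -morphX ?cycle_id // expT morph1.
have [b] := abelian_structure abT.
(* Generalized to the subgroup generated by any list of direct factors, for induction on the
   list. *)
suff main (A : {group gT}) : \big[dprod/1]_(x <- b) <[x]> = A ->
    group_iso (subg_of A) (dual (subg_of A)).
  move=> /main isoT _.
  have isoS : group_iso gT (subg_of [set: gT]).
    exists (subg [set: gT]); last by move=> x y; rewrite -morphM ?inE.
    by exists sgval => x; [apply: subgK; rewrite inE | exact: sgvalK].
  apply: (group_iso_trans isoS (group_iso_trans isoT _)).
  exact: group_iso_sym (dual_iso isoS).
elim: b A => [|x b IHb] A; rewrite ?big_nil ?big_cons.
  move=> defA; apply: (@dual_cyclic _ 1); last exact: expg1n.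
  apply/setP => u; rewrite cycle1 !inE; apply/esym/eqP/val_inj.
  suff: sgval u \in [1 gT] by move/set1P.
  by move: (subgP u); rewrite -defA.
move=> defA; have [[_ B _ defB] _ _ _] := dprodP defA.
rewrite defB in defA; have isoA := subg_dprod defA.
apply: group_iso_trans (group_iso_sym isoA) _.
apply: group_iso_trans (group_iso_prod (cyc x) (IHb B defB)) _.
apply: group_iso_trans (dual_iso isoA).
exact/group_iso_sym/dual_prod.
Qed.

Lemma group_iso_cancel_dual gT hT :
  group_iso (dual gT * gT)%type (dual hT * hT)%type -> group_iso gT hT.
Proof.
move=> isoW; have isoDW := dual_iso isoW.
(* Hence the dual of [dual gT * gT] is isomorphic to the square of [dual gT], and its homomorphism
   counts are perfect squares. *)
have dd kT : group_iso (dual kT) (dual (dual kT)).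
  apply: dual_abelian_iso; last exact: dual_exponent.
  by apply/centsP => x _ y _; exact: dual_abelian.
have eq_dual (kT : finGroupType) (S : {set kT}) :
    #|homs S (dual gT)| = #|homs S (dual hT)|.
  have := card_homs_iso S isoDW.
  rewrite !(card_homs_iso S (dual_prod _ _)) !card_homs_prod.
  rewrite -!(card_homs_iso S (dd _)) => /eqP.
  by rewrite !mulnn eqn_sqr => /eqP.
(* The factor counting maps into the dual is now common to both sides and positive, so it
   cancels. *)
apply: group_iso_from_card_homs => kT S; have := card_homs_iso S isoW.
rewrite !card_homs_prod eq_dual => /eqP.
by rewrite eqn_pmul2l ?homs_gt0 // => /eqP.
Qed.

End Dual.

End GroupCancellation.

Local Open Scope ring_scope.

(** * Multilinear extension *)

Section LinearExtension.

Variable C : fieldType.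

Lemma lin_ext_linear (I : finType) (W : lmodType C) (F : I -> W) :
  linear (lin_ext F).
Proof.
move=> a u v; rewrite /lin_ext scaler_sumr -big_split /=; apply: eq_bigr => i _.
by rewrite !ffunE scalerDl scalerA.
Qed.

HB.instance Definition _ (I : finType) (W : lmodType C) (F : I -> W) :=
  GRing.isLinear.Build C (coord_space C I) W _ (lin_ext F) (lin_ext_linear F).

Lemma lin_ext_basis (I : finType) (W : lmodType C) (F : I -> W) i :
  lin_ext F (basisv C i) = F i.
Proof.
rewrite /lin_ext (bigD1 i) //= ffunE eqxx scale1r big1 ?addr0 // => j ji.
by rewrite ffunE (negbTE ji) scale0r.
Qed.

Lemma coord_spaceE (I : finType) (u : coord_space C I) :
  u = \sum_i u i *: basisv C i.
Proof.
apply/ffunP => j; rewrite sum_ffunE (bigD1 j) //= big1 => [|i ij];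
  rewrite !ffunE; first by rewrite eqxx /GRing.scale /= mulr1 addr0.
by rewrite eq_sym (negbTE ij) /GRing.scale /= mulr0.
Qed.

(** Stated for bare functions with a linearity hypothesis, since the structure operations are plain
    fields of a record. *)
Lemma linear_lin_ext (I : finType) (W : lmodType C) (f : coord_space C I -> W) :
  linear f -> f =1 lin_ext (f \o basisv C (I := I)).
Proof.
move=> lin_f u; pose f' := GRing.isLinear.Build C _ _ _ f lin_f.
pose F : {linear _ -> _} := HB.pack f f'.
rewrite [in LHS](coord_spaceE u) -[f _]/(F _) linear_sum.
by apply: eq_bigr => i _; exact: (linearZ_LR F).
Qed.

Lemma eq_on_basis (I : finType) (W : lmodType C) (f g : coord_space C I -> W) :
  linear f -> linear g -> (forall i, f (basisv C i) = g (basisv C i)) -> f =1 g.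
Proof.
move=> lf lg fg u; rewrite linear_lin_ext // [RHS]linear_lin_ext //.
by apply: eq_bigr => i _; rewrite /= fg.
Qed.

Lemma linear_fun0 (V W : lmodType C) (f : V -> W) : linear f -> f 0 = 0.
Proof.
move=> lin_f; apply: (addrI (f 0)).
by rewrite -{1}[f 0]scale1r -lin_f scaler0 !addr0.
Qed.

Lemma linear_funZ (V W : lmodType C) (f : V -> W) a u :
  linear f -> f (a *: u) = a *: f u.
Proof.
by move=> lin_f; rewrite -[a *: u]addr0 lin_f linear_fun0 // addr0.
Qed.

Lemma linear_fun_sum (V W : lmodType C) (f : V -> W) (I : finType) (P : pred I)
    (F : I -> V) :
  linear f -> f (\sum_(i | P i) F i) = \sum_(i | P i) f (F i).
Proof.
move=> lin_f; apply: (big_morph f) => [u v|].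
  by rewrite -[u]scale1r lin_f !scale1r.
exact: linear_fun0.
Qed.

Definition bilinear_fun (U V W : lmodType C) (b : U -> V -> W) :=
  (forall u, linear (b u)) /\ (forall v, linear (b^~ v)).

Lemma tens_bilinear (I J : finType) : bilinear_fun (@tens C I J).
Proof.
split=> [u|v] a x y; apply/ffunP => -[i j]; rewrite !ffunE /= /GRing.scale /=.
  by rewrite mulrDr mulrCA.
by rewrite mulrDl mulrA.
Qed.

Lemma tens_basis (I J : finType) (i : I) (j : J) :
  tens (basisv C i) (basisv C j) = basisv C (i, j).
Proof. by apply/ffunP => -[i' j']; rewrite !ffunE /= -natrM mulnb. Qed.

(** The universal property of the tensor product: for bilinear [b], the induced linear map. *)
Definition tens_ext (I J : finType) (W : lmodType C)
    (b : coord_space C I -> coord_space C J -> W) :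
    coord_space C (I * J)%type -> W :=
  lin_ext (fun p => b (basisv C p.1) (basisv C p.2)).

Lemma tens_ext_linear (I J : finType) (W : lmodType C)
    (b : coord_space C I -> coord_space C J -> W) :
  linear (tens_ext b).
Proof. exact: lin_ext_linear. Qed.

Lemma tens_ext_basis (I J : finType) (W : lmodType C)
    (b : coord_space C I -> coord_space C J -> W) i j :
  tens_ext b (basisv C (i, j)) = b (basisv C i) (basisv C j).
Proof. by rewrite /tens_ext lin_ext_basis. Qed.

Lemma tens_ext_tens (I J : finType) (W : lmodType C)
    (b : coord_space C I -> coord_space C J -> W) u v :
  bilinear_fun b -> tens_ext b (tens u v) = b u v.
Proof.
move=> [bl br]; have [tl tr] := tens_bilinear I J.
have lin1 x : linear (fun y => tens_ext b (tens x y)).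
  by move=> a y z; rewrite tl; exact: lin_ext_linear.
have lin2 y : linear (fun x => tens_ext b (tens x y)).
  by move=> a x z; rewrite tr; exact: lin_ext_linear.
move: u; apply: eq_on_basis => // i; move: v; apply: eq_on_basis => // j.
by rewrite tens_basis /tens_ext lin_ext_basis.
Qed.

Lemma tens_map_tens (I I' J J' : finType)
    (f : {linear coord_space C I -> coord_space C J})
    (f' : {linear coord_space C I' -> coord_space C J'}) u v :
  tens_map f f' (tens u v) = tens (f u) (f' v).
Proof.
have [tl tr] := tens_bilinear J J'.
apply: (@tens_ext_tens _ _ _ (fun u v => tens (f u) (f' v))).
by split=> [x|y] a z t; rewrite linearP ?tl ?tr.
Qed.

(** Naturality of the induced map. It transports a product taken over Sweedler components along a
    morphism. *)
Lemma tens_map_ext (I I' J J' : finType) (V W : lmodType C)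
    (f : {linear coord_space C I -> coord_space C J})
    (f' : {linear coord_space C I' -> coord_space C J'})
    (g : {linear V -> W}) b b' :
    bilinear_fun b' -> (forall u v, g (b u v) = b' (f u) (f' v)) ->
  forall z, g (tens_ext b z) = tens_ext b' (tens_map f f' z).
Proof.
move=> bil gb z.
pose tb : {linear _ -> _} := lin_ext (fun p => b (basisv C p.1) (basisv C p.2)).
pose tb' : {linear _ -> _} :=
  lin_ext (fun p => b' (basisv C p.1) (basisv C p.2)).
pose tf : {linear _ -> _} :=
  lin_ext (fun p => tens (f (basisv C p.1)) (f' (basisv C p.2))).
rewrite -[tens_ext b _]/(tb _) -[tens_ext b' _]/(tb' (tf _)) !linear_sum /=.
apply: eq_bigr => p _; rewrite !linearZ /= gb.
by congr (_ *: _); rewrite -(tens_ext_tens _ _ bil).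
Qed.

End LinearExtension.

(** * Antipode and beta *)

#[local] Arguments qh_mul : simpl never.
#[local] Arguments qh_comul : simpl never.
#[local] Arguments qh_antipode : simpl never.

Section TwistedDouble.

Variables (C : fieldType) (gT : finGroupType) (w : gT -> gT -> gT -> C).

Lemma qh_mul_bilinear : bilinear_fun (qh_mul (twisted_double w)).
Proof.
split=> [u|v] a x y; rewrite /qh_mul /=.
  rewrite /lin_ext scaler_sumr -big_split; apply: eq_bigr => -[g h] _ /=.
  by rewrite -[X in u _ *: X]/(lin_ext _ _) linearP scalerDr !scalerA mulrC.
exact: lin_ext_linear.
Qed.

Lemma qh_antipode_linear : linear (qh_antipode (twisted_double w)).
Proof. exact: lin_ext_linear. Qed.

Lemma qh_comul_linear : linear (qh_comul (twisted_double w)).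
Proof. exact: lin_ext_linear. Qed.

Lemma qh_mul_basis g x h y :
  qh_mul (twisted_double w) (basisv C (g, x)) (basisv C (h, y)) =
  ((g == h ^ x^-1)%g%:R * theta w g x y) *: basisv C (g, (x * y)%g).
Proof. by rewrite /qh_mul /= !lin_ext_basis. Qed.

Lemma qh_antipode_basis g x :
  qh_antipode (twisted_double w) (basisv C (g, x)) =
  ((theta w g^-1%g x x^-1%g)^-1 * (gamma w x g g^-1%g)^-1) *:
    basisv C ((g^-1 ^ x)%g, x^-1%g).
Proof. by rewrite /qh_antipode /= lin_ext_basis. Qed.

Lemma qh_comul_basis g x :
  qh_comul (twisted_double w) (basisv C (g, x)) =
  \sum_(t : gT) gamma w x (g * t^-1)%g t *:
     basisv C (((g * t^-1)%g, x), (t, x)).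
Proof.
rewrite /qh_comul /= lin_ext_basis; apply: eq_bigr => t _.
by rewrite tens_basis.
Qed.

Hypothesis w_neq0 : forall a b c, w a b c != 0.

Lemma theta_neq0 g x y : theta w g x y != 0.
Proof. by rewrite /theta !mulf_neq0 ?invr_neq0. Qed.

Lemma gamma_neq0 x g h : gamma w x g h != 0.
Proof. by rewrite /gamma !mulf_neq0 ?invr_neq0. Qed.

End TwistedDouble.

Section Double.

Variables (C : fieldType) (gT : finGroupType).
Notation D0 := (drinfeld_double C gT).

Lemma theta_trivial (g x y : gT) : theta (fun _ _ _ => 1 : C) g x y = 1.
Proof. by rewrite /theta mulr1 divr1. Qed.

Lemma gamma_trivial (x g h : gT) : gamma (fun _ _ _ => 1 : C) x g h = 1.
Proof. by rewrite /gamma mulr1 divr1. Qed.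

Lemma double_mul_basis (g x h y : gT) :
  qh_mul D0 (basisv C (g, x)) (basisv C (h, y)) =
  (g == h ^ x^-1)%g%:R *: basisv C (g, (x * y)%g).
Proof. by rewrite qh_mul_basis theta_trivial mulr1. Qed.

Lemma double_antipode_basis (g x : gT) :
  qh_antipode D0 (basisv C (g, x)) = basisv C ((g^-1 ^ x)%g, x^-1%g).
Proof.
by rewrite qh_antipode_basis theta_trivial gamma_trivial invr1 mulr1 scale1r.
Qed.

Lemma double_comul_basis (g x : gT) :
  qh_comul D0 (basisv C (g, x)) =
  \sum_(t : gT) basisv C (((g * t^-1)%g, x), (t, x)).
Proof.
by rewrite qh_comul_basis; apply: eq_bigr => t _; rewrite gamma_trivial scale1r.
Qed.

End Double.

(** * Diagonal operators for the factors of the twisted antipode *)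

Section Operators.

Variables (C : fieldType) (gT : finGroupType) (w : gT -> gT -> gT -> C).
Notation A := (twisted_double w).
Notation D0 := (drinfeld_double C gT).
Notation V := (coord_space C (gT * gT)%type).

(* In Sweedler notation, [S_0(u_1 *_w S_0(u_2))] for [Delta_0],
   [u_1 *_0 S_0(u_2)] for [Delta_w], and [q(u_2) *_0 u_1] for [Delta_0]. *)
Definition theta_sum (u : V) : V :=
  qh_antipode D0
    (tens_ext (fun a b => qh_mul A a (qh_antipode D0 b)) (qh_comul D0 u)).

Definition gamma_sum (u : V) : V :=
  tens_ext (fun a b => qh_mul D0 a (qh_antipode D0 b)) (qh_comul A u).

Definition act_by (q : V -> V) (u : V) : V :=
  tens_ext (fun a b => qh_mul D0 (q b) a) (qh_comul D0 u).

Lemma double_mul_linearl u : linear ((qh_mul D0)^~ u).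
Proof. exact: (qh_mul_bilinear _).2. Qed.

Lemma double_mul_linearr u : linear (qh_mul D0 u).
Proof. exact: (qh_mul_bilinear _).1. Qed.

(** The product of [e_{g t^-1} # x] with [S_0(e_t # x)] vanishes unless [g = 1], and then lies on
    [e_{t^-1} # 1]; the outer [S_0] turns [t^-1] back into [t]. *)
Lemma theta_sum_basis g x :
  theta_sum (basisv C (g, x)) =
  (g == 1%g)%:R *: \sum_t theta w t^-1%g x x^-1%g *: basisv C (t, 1%g).
Proof.
rewrite /theta_sum double_comul_basis (linear_fun_sum _ _ (tens_ext_linear _)).
rewrite (linear_fun_sum _ _ (qh_antipode_linear _)) scaler_sumr.
apply: eq_bigr => t _; rewrite tens_ext_basis double_antipode_basis.
rewrite qh_mul_basis conjgK mulgV -[X in _ == X]mul1g (inj_eq (mulIg _)).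
rewrite (linear_funZ _ _ (qh_antipode_linear _)) double_antipode_basis.
rewrite conjg1 invg1 -scalerA.
by case: eqP => [->|_]; rewrite ?scale0r // mul1g invgK.
Qed.

Lemma gamma_sum_basis g x :
  gamma_sum (basisv C (g, x)) =
  (g == 1%g)%:R *: \sum_t gamma w x t t^-1%g *: basisv C (t, 1%g).
Proof.
rewrite /gamma_sum qh_comul_basis (linear_fun_sum _ _ (tens_ext_linear _)).
(* The surviving vector is [e_{t^-1} # 1], with no outer antipode here, so the target sum is
   reindexed by inversion. *)
rewrite [in RHS](reindex_inj (@invg_inj gT)) scaler_sumr /=.
apply: eq_bigr => t _; rewrite (linear_funZ _ _ (tens_ext_linear _)).
rewrite tens_ext_basis double_antipode_basis double_mul_basis.
rewrite conjgK mulgV -[X in _ == X]mul1g (inj_eq (mulIg _)) invgK.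
by case: eqP => [->|_]; rewrite ?mul1g ?scale1r ?scale0r ?scaler0.
Qed.

Lemma double_mul_act (c : gT -> C) g x :
  qh_mul D0 (\sum_t c t *: basisv C (t, 1%g)) (basisv C (g, x)) =
  c g *: basisv C (g, x).
Proof.
rewrite (linear_fun_sum _ _ (double_mul_linearl _)) (bigD1 g) //=.
rewrite [X in _ + X]big1 => [|t tg];
  rewrite (linear_funZ _ _ (double_mul_linearl _)) double_mul_basis;
  rewrite invg1 conjg1 mul1g.
  by rewrite eqxx scale1r addr0.
by rewrite (negbTE tg) scale0r scaler0.
Qed.

(** As [q] kills [e_t # x] for [t != 1], only the term [e_g # x] tensor [e_1 # x] of the coproduct
    survives, and left multiplication by [q(e_1 # x)] is diagonal. *)
Lemma act_by_basis (q : V -> V) (c : gT -> gT -> C) :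
    (forall g x, q (basisv C (g, x)) =
      (g == 1%g)%:R *: \sum_t c x t *: basisv C (t, 1%g)) ->
  forall g x, act_by q (basisv C (g, x)) = c x g *: basisv C (g, x).
Proof.
move=> q_basis g x; rewrite /act_by double_comul_basis.
rewrite (linear_fun_sum _ _ (tens_ext_linear _)) (bigD1 1%g) //=.
rewrite [X in _ + X]big1 => [|t t1]; rewrite tens_ext_basis q_basis.
  by rewrite eqxx scale1r invg1 mulg1 double_mul_act addr0.
by rewrite (negbTE t1) scale0r (linear_fun0 (double_mul_linearl _)).
Qed.

Lemma theta_act_basis g x :
  act_by theta_sum (basisv C (g, x)) =
  theta w g^-1%g x x^-1%g *: basisv C (g, x).
Proof.
exact: (act_by_basis (c := fun x g => theta w g^-1%g x x^-1%g) theta_sum_basis).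
Qed.

Lemma gamma_act_basis g x :
  act_by gamma_sum (basisv C (g, x)) = gamma w x g g^-1%g *: basisv C (g, x).
Proof.
exact: (act_by_basis (c := fun x g => gamma w x g g^-1%g) gamma_sum_basis).
Qed.

Lemma act_by_linear q : linear (act_by q).
Proof.
by move=> a u v; rewrite /act_by (qh_comul_linear _) (tens_ext_linear _).
Qed.

Hypothesis w_neq0 : forall a b c, w a b c != 0.

(** The two operators multiply by exactly the factors whose inverses occur in the twisted
    antipode. *)
Lemma antipode_act u :
  qh_antipode A (act_by theta_sum (act_by gamma_sum u)) = qh_antipode D0 u.
Proof.
move: u; apply: eq_on_basis; [|exact: qh_antipode_linear|] => [a u v|[g x]].
  by rewrite !act_by_linear qh_antipode_linear.
rewrite gamma_act_basis (linear_funZ _ _ (act_by_linear _)) theta_act_basis.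
rewrite !(linear_funZ _ _ (qh_antipode_linear _)) double_antipode_basis.
rewrite qh_antipode_basis !scalerA -invfM [X in X^-1]mulrC mulfV ?scale1r //.
by rewrite mulf_neq0 ?theta_neq0 ?gamma_neq0.
Qed.

Lemma act_surj u : exists v, u = act_by theta_sum (act_by gamma_sum v).
Proof.
(* The composite is diagonal with eigenvalues [c p], all nonzero, so a preimage is found by dividing
   coordinates. *)
pose c p := gamma w p.2 p.1 p.1^-1%g * theta w p.1^-1%g p.2 p.2^-1%g.
exists [ffun p => u p / c p].
have lin_act q := linear_fun_sum _ _ (act_by_linear q).
have lin_actZ q := linear_funZ _ _ (act_by_linear q).
rewrite [X in act_by gamma_sum X]coord_spaceE (lin_act _ _ _ gamma_sum)
  (lin_act _ _ _ theta_sum) [LHS]coord_spaceE.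
apply: eq_bigr => -[g x] _.
rewrite (lin_actZ _ _ gamma_sum) (lin_actZ _ _ theta_sum)
  gamma_act_basis (lin_actZ _ _ theta_sum).
rewrite theta_act_basis !scalerA ffunE -mulrA divfK //.
by rewrite mulf_neq0 ?theta_neq0 ?gamma_neq0.
Qed.

End Operators.

(** * Recovering beta from the coassociator *)

Section Beta.

Variable C : fieldType.

Lemma antipode_mul_bilinear (kT : finGroupType) (v : kT -> kT -> kT -> C) :
  bilinear_fun (fun a b =>
    qh_mul (twisted_double v) a (qh_antipode (drinfeld_double C kT) b)).
Proof.
have [bl br] := qh_mul_bilinear v.
by split=> // u a x y; rewrite qh_antipode_linear bl.
Qed.

Lemma theta_sum_linear (kT : finGroupType) (v : kT -> kT -> kT -> C) :
  linear (theta_sum v).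
Proof.
move=> a x y; rewrite /theta_sum (qh_comul_linear _) (tens_ext_linear _).
exact: qh_antipode_linear.
Qed.

Lemma gamma_sum_linear (kT : finGroupType) (v : kT -> kT -> kT -> C) :
  linear (gamma_sum v).
Proof.
by move=> a x y; rewrite /gamma_sum qh_comul_linear (tens_ext_linear _).
Qed.

(* [S_0] applied to the middle leg of the coassociator, followed by [*_0],
   yields the inverse of [beta]. *)
Definition beta_inverse (kT : finGroupType) (v : kT -> kT -> kT -> C) :
    coord_space C (kT * kT)%type :=
  tens_ext (fun y c => qh_mul (drinfeld_double C kT)
      (tens_ext (fun a b => qh_mul (drinfeld_double C kT) a
                              (qh_antipode (drinfeld_double C kT) b)) y) c)
    (qh_coassociator (twisted_double v)).

(** The untwisted product of [e_a], [S_0(e_b)], [e_c] is nonzero only for [b = a^-1] and [c = a]. *)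
Lemma beta_inverseE (kT : finGroupType) (v : kT -> kT -> kT -> C) :
  beta_inverse v = \sum_g (v g g^-1%g g)^-1 *: basisv C (g, 1%g).
Proof.
rewrite /beta_inverse /qh_coassociator /=.
rewrite (linear_fun_sum _ _ (tens_ext_linear _)); apply: eq_bigr => a _.
rewrite (linear_fun_sum _ _ (tens_ext_linear _)).
have termE b c : tens_ext (fun y c => qh_mul (drinfeld_double C kT)
      (tens_ext (fun a b => qh_mul (drinfeld_double C kT) a
                              (qh_antipode (drinfeld_double C kT) b)) y) c)
    ((v a b c)^-1 *: tens (tens (basisv C (a, 1%g)) (basisv C (b, 1%g)))
                          (basisv C (c, 1%g))) =
    ((a == c)%:R * (a == b^-1)%g%:R * (v a b c)^-1) *: basisv C (a, 1%g).
  rewrite (linear_funZ _ _ (tens_ext_linear _)) !tens_basis !tens_ext_basis.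
  rewrite double_antipode_basis double_mul_basis.
  rewrite (linear_funZ _ _ (double_mul_linearl _)) double_mul_basis !scalerA.
  by rewrite !(invg1, conjg1, mulg1) -mulrA mulrC [X in X * _]mulrC.
rewrite (bigD1 a^-1%g) //= [X in _ + X]big1 ?addr0 => [|b ba].
  rewrite (linear_fun_sum _ _ (tens_ext_linear _)) (bigD1 a) //= termE.
  rewrite [X in _ + X]big1 ?addr0 => [|c ca].
    by rewrite invgK !eqxx !mul1r.
  by rewrite termE eq_sym (negbTE ca) !mul0r scale0r.
rewrite (linear_fun_sum _ _ (tens_ext_linear _)) big1 // => c _.
have /negbTE ab : a != b^-1%g by apply: contraNneq ba => ->; rewrite invgK.
by rewrite termE ab mulr0 mul0r scale0r.
Qed.

Lemma beta_mul_inverse (kT : finGroupType) (v : kT -> kT -> kT -> C) :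
    (forall a b c, v a b c != 0) ->
  qh_mul (drinfeld_double C kT) (qh_beta (twisted_double v)) (beta_inverse v) =
  qh_one (drinfeld_double C kT).
Proof.
move=> v_neq0; rewrite beta_inverseE.
rewrite (linear_fun_sum _ _ (double_mul_linearr _)).
apply: eq_bigr => g _; rewrite (linear_funZ _ _ (double_mul_linearr _)).
by rewrite double_mul_act scalerA mulVf ?scale1r.
Qed.

Lemma double_mul_sumr (kT : finGroupType) (c : kT -> C) g x y :
  qh_mul (drinfeld_double C kT) (basisv C (g, x))
    (\sum_t c t *: basisv C (t, y)) = c (g ^ x)%g *: basisv C (g, (x * y)%g).
Proof.
rewrite (linear_fun_sum _ _ (double_mul_linearr _)) (bigD1 (g ^ x)%g) //=.
rewrite [X in _ + X]big1 => [|t tg];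
  rewrite (linear_funZ _ _ (double_mul_linearr _)) double_mul_basis.
  by rewrite conjgK eqxx scale1r addr0.
by rewrite -(inj_eq (conjg_inj x)) conjgKV eq_sym (negbTE tg) scale0r scaler0.
Qed.

(** Right multiplication by such an element rescales [e_g # x] by [c (g ^ x)]. This gives right
    cancellation without appeal to associativity. *)
Lemma double_mul_diagK (kT : finGroupType) (c : kT -> C) :
  (forall t, c t != 0) ->
  cancel
    (qh_mul (drinfeld_double C kT) ^~ (\sum_t c t *: basisv C (t, 1%g)))
    (qh_mul (drinfeld_double C kT) ^~ (\sum_t (c t)^-1 *: basisv C (t, 1%g))).
Proof.
move=> c_neq0; apply: eq_on_basis => [a x y|a x y //|[g x]].
  by rewrite !double_mul_linearl.
rewrite double_mul_sumr mulg1 (linear_funZ _ _ (double_mul_linearl _)).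
by rewrite double_mul_sumr mulg1 scalerA mulfV ?scale1r.
Qed.

End Beta.

(** * Transport along a rigid isomorphism *)

Section AntipodeBeta.

Variables (C : fieldType) (gT hT : finGroupType).
Variables (w : gT -> gT -> gT -> C) (eta : hT -> hT -> hT -> C).
Variable f : {linear coord_space C (gT * gT)%type ->
                     coord_space C (hT * hT)%type}.
Hypothesis fH : hopf_morphism (drinfeld_double C gT) (drinfeld_double C hT) f.

Lemma act_by_morph (q : coord_space C (gT * gT)%type -> _)
    (q' : coord_space C (hT * hT)%type -> _) :
  (forall u, f (q u) = q' (f u)) -> linear q' ->
  forall u, f (act_by q u) = act_by q' (f u).
Proof.
move=> fq lin_q' u; have [[_ fM] [fD _] _] := fH; rewrite /act_by fD.
apply: tens_map_ext => [|a b]; last by rewrite fM fq.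
split=> v a x y; first by rewrite lin_q' double_mul_linearl.
exact: double_mul_linearr.
Qed.

Hypothesis fQ :
  quasi_bialgebra_morphism (twisted_double w) (twisted_double eta) f.

(** Rigidity enters here: the formula mixes the twisted product with the untwisted coproduct and
    antipode, and [f] respects all three. *)
Lemma theta_sum_morph u : f (theta_sum w u) = theta_sum eta (f u).
Proof.
have [_ [fD _] fS] := fH; have [[_ fM] _ _] := fQ; rewrite /theta_sum fS fD.
congr (qh_antipode _ _).
apply: tens_map_ext; first exact: antipode_mul_bilinear.
by move=> a b; rewrite fM fS.
Qed.

Lemma gamma_sum_morph u : f (gamma_sum w u) = gamma_sum eta (f u).
Proof.
have [[_ fM] _ fS] := fH; have [_ [fD _] _] := fQ; rewrite /gamma_sum fD.
apply: tens_map_ext; first exact: antipode_mul_bilinear.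
by move=> a b; rewrite fM fS.
Qed.

Hypothesis w_neq0 : forall a b c, w a b c != 0.
Hypothesis eta_neq0 : forall a b c, eta a b c != 0.

Lemma rigid_antipode :
  antipode_compatible (twisted_double w) (twisted_double eta) f.
Proof.
(* On vectors of this form the twisted antipode becomes [S_0], which [f] preserves; the operators
   themselves commute with [f]. *)
move=> u; have [v ->] := act_surj w_neq0 u; have [_ _ fS] := fH.
have lin_t := theta_sum_linear eta; have lin_g := gamma_sum_linear eta.
rewrite antipode_act // fS -(antipode_act eta_neq0); congr (qh_antipode _ _).
rewrite (act_by_morph theta_sum_morph) //; congr (act_by _ _).
by rewrite (act_by_morph gamma_sum_morph).
Qed.

Lemma rigid_beta :
  f (qh_beta (twisted_double w)) = qh_beta (twisted_double eta).
Proof.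
have [[f1 fM] _ fS] := fH; have [_ _ fphi] := fQ.
have f_inv : f (beta_inverse w) = beta_inverse eta.
  rewrite /beta_inverse -fphi.
  have lin_m (kT : finGroupType) := tens_ext_linear
    (fun a b => qh_mul (drinfeld_double C kT) a
                  (qh_antipode (drinfeld_double C kT) b)).
  (* Naturality is used twice on the triple tensor product; the outer use needs [tens_map f f] as a
     linear map on the first factor. *)
  pose g : {linear _ -> _} := HB.pack (tens_map f f)
    (GRing.isLinear.Build C _ _ _ (tens_map f f) (@lin_ext_linear _ _ _ _)).
  apply: (@tens_map_ext _ _ _ _ _ _ _ g) => [|y c].
    split=> [u|u] a x y; first exact: double_mul_linearr.
    by rewrite lin_m double_mul_linearl.
  rewrite fM; congr (qh_mul _ _ _).
  apply: tens_map_ext; first exact: antipode_mul_bilinear.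
  by move=> a b; rewrite fM fS.
have cancel_beta :=
  double_mul_diagK (kT := hT) (c := fun g => (eta g g^-1%g g)^-1).
(* Both candidates for beta give the unit when multiplied by [beta_inverse eta]. *)
apply: (can_inj (cancel_beta _)) => [g|].
  by rewrite invr_eq0.
by rewrite /= -beta_inverseE beta_mul_inverse // -f_inv -fM beta_mul_inverse.
Qed.

End AntipodeBeta.

(** * Group-like elements of the double *)

(** In characteristic 0 the polynomial ['X^n - 1] is separable, so it has [n] distinct roots, and
    these include a primitive one. *)
Lemma prim_root_exists (C : numClosedFieldType) n :
  (0 < n)%N -> exists z : C, n.-primitive_root z.
Proof.
move=> n_gt0; have [r] := closed_field_poly_normal ('X^n - 1 : {poly C}).
rewrite (monicP (monicXnsubC _ n_gt0)) scale1r => defr.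
have r_unity : all n.-unity_root r.
  by apply/allP => z; rewrite -root_prod_XsubC -defr.
have r_uniq : uniq r.
  by rewrite -separable_prod_XsubC -defr separable_Xn_sub_1 // pnatr_eq0 -lt0n.
have r_size : (n <= size r)%N.
  by rewrite -ltnS -(size_prod_XsubC r id) -defr size_XnsubC.
have /hasP[z _ z_prim] := has_prim_root n_gt0 r_unity r_uniq r_size.
by exists z.
Qed.

Lemma double_comulE (C : fieldType) (gT : finGroupType)
    (u : coord_space C (gT * gT)%type) :
  qh_comul (drinfeld_double C gT) u =
  [ffun q => (q.1.2 == q.2.2)%:R * u ((q.1.1 * q.2.1)%g, q.1.2)].
Proof.
move: u; apply: eq_on_basis; first exact: qh_comul_linear.
  move=> a x y; apply/ffunP => q; rewrite !ffunE /GRing.scale /=.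
  by rewrite mulrDr mulrCA.
move=> [g x]; rewrite double_comul_basis; apply/ffunP => -[[h a] [t b]].
rewrite sum_ffunE ffunE /= (bigD1 t) //= [X in _ + X]big1 => [|s st].
  rewrite !ffunE !xpair_eqE eqxx /= addr0 -natrM mulnb.
  rewrite -(inj_eq (mulIg t)) mulgKV; congr (_%:R); congr nat_of_bool.
  by case: (a =P x) => [->|]; rewrite ?andbF ?andbT ?(eq_sym x) // andbC.
by rewrite ffunE !xpair_eqE [t == s]eq_sym (negbTE st) /= andbF.
Qed.

Lemma double_counitE (C : fieldType) (gT : finGroupType)
    (u : coord_space C (gT * gT)%type) :
  qh_counit (drinfeld_double C gT) u = \sum_x u (1%g, x).
Proof.
rewrite /qh_counit /= /lin_ext.
rewrite (eq_bigr (fun p => u (p.1, p.2) *: ((p.1 == 1%g)%:R : C^o)));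
  last by case.
rewrite -(pair_bigA _ (fun g x => u (g, x) *: ((g == 1%g)%:R : C^o))) /=.
rewrite (bigD1 1%g) //= [X in _ + X]big1 => [|g /negbTE->].
  by rewrite addr0; apply: eq_bigr => x _; rewrite eqxx /GRing.scale /= mulr1.
by rewrite big1 // => x _; rewrite scaler0.
Qed.

Section GroupLike.

Variables (C : fieldType) (n : nat) (z : C).
Hypothesis z_prim : n.+1.-primitive_root z.

Section OneGroup.

Variable gT : finGroupType.
Hypothesis dvd_gT : (#|gT| %| n.+1)%N.
Notation D0 := (drinfeld_double C gT).
Implicit Types p q : (dual n gT * gT)%type.

(** For [p = (chi, x)] this is [chi # x], where [chi] stands for the complex-style character
    [g |-> z ^+ chi g], viewed as a function on the group. *)
Definition grouplike p : coord_space C (gT * gT)%type :=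
  [ffun q => (q.2 == p.2)%:R * z ^+ p.1 q.1].

Lemma grouplikeE p :
  grouplike p = \sum_g z ^+ p.1 g *: basisv C (g, p.2).
Proof.
apply/ffunP => -[g x]; rewrite ffunE sum_ffunE (bigD1 g) //= big1 => [|h hg].
  by rewrite !ffunE xpair_eqE eqxx /= addr0 /GRing.scale /= mulrC.
by rewrite !ffunE xpair_eqE [g == h]eq_sym (negbTE hg) scaler0.
Qed.

Lemma prim_root_mul (i j : 'I_n.+1) : z ^+ (i * j)%g = z ^+ i * z ^+ j.
Proof. by rewrite -exprD -(prim_expr_mod z_prim (i + j)). Qed.

Lemma prim_root_inj : injective (fun i : 'I_n.+1 => z ^+ i).
Proof.
move=> i j /eqP; rewrite (eq_prim_root_expr z_prim) !modn_small // => /eqP.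
exact: val_inj.
Qed.

Lemma dual1 (f : dual n gT) : f 1%g = 1%g.
Proof. exact/morph1_fun/dual_morph. Qed.

Lemma grouplike_inj : injective grouplike.
Proof.
move=> [f x] [f' x'] /ffunP eq_gl.
have eq_x : x = x'.
  have := eq_gl (1%g, x); rewrite !ffunE /= !dual1 eqxx !expr0 !mulr1.
  by case: eqP => // _ /eqP; rewrite oner_eq0.
congr (_, _) => //; apply: dual_eq => g; apply: prim_root_inj.
by have := eq_gl (g, x); rewrite !ffunE /= eq_x eqxx !mul1r.
Qed.

Lemma grouplike_mul p q :
  grouplike (p * q)%g = qh_mul D0 (grouplike p) (grouplike q).
Proof.
rewrite !grouplikeE (linear_fun_sum _ _ (double_mul_linearl _)).
apply: eq_bigr => g _; rewrite (linear_funZ _ _ (double_mul_linearl _)).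
rewrite double_mul_sumr scalerA; congr (_ *: _).
rewrite -prim_root_mul; congr (z ^+ _).
(* Characters are invariant under conjugation, which is why the group-likes form a direct
   product. *)
have -> : dual_fun q.1 (g ^ p.2)%g = dual_fun q.1 g.
  by rewrite !dual_morph ordinal_mulgC -!dual_morph mulgK.
by rewrite dualM.
Qed.

Lemma grouplike_comul p :
  qh_comul D0 (grouplike p) = tens (grouplike p) (grouplike p).
Proof.
rewrite double_comulE; apply/ffunP => -[[h a] [t b]]; rewrite !ffunE /=.
case: (a =P b) => [->|ab]; rewrite ?mul0r ?mul1r.
  case: (b == _); rewrite ?mul0r ?mul1r //.
  by rewrite dual_morph prim_root_mul.
have [eq_a|] := a =P p.2; rewrite ?mul0r // mul1r.
by have [eq_b|] := b =P p.2; rewrite ?mul0r ?mulr0 //; case: ab; rewrite eq_a.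
Qed.

Lemma grouplike_counit p : qh_counit D0 (grouplike p) = 1.
Proof.
rewrite double_counitE (bigD1 p.2) //= big1 => [|x /negbTE xp].
  by rewrite ffunE /= eqxx dual1 expr0 mulr1 addr0.
by rewrite ffunE /= xp mul0r.
Qed.

(** In coordinates, group-likeness is a functional equation: it concentrates [u] on a single [x] and
    makes [g |-> u (g, x)] multiplicative. *)
Lemma grouplikeP u :
  qh_comul D0 u = tens u u -> qh_counit D0 u = 1 -> exists p, u = grouplike p.
Proof.
rewrite double_comulE double_counitE => /ffunP uD u1.
have {}uD h x t y : (x == y)%:R * u ((h * t)%g, x) = u (h, x) * u (t, y).
  by have := uD ((h, x), (t, y)); rewrite !ffunE.
have [x ux_neq0] : exists x, u (1%g, x) != 0.
  apply/existsP; apply: contraT; rewrite negb_exists => /forallP u0.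
  have := oner_neq0 C; rewrite -u1 big1 ?eqxx // => x _.
  by apply/eqP; have := u0 x; rewrite negbK.
(* The equation at [h = t = 1] makes this nonzero value idempotent. *)
have ux1 : u (1%g, x) = 1.
  by apply: (mulfI ux_neq0); rewrite -uD eqxx mulg1 mul1r mulr1.
have u_out t y : y != x -> u (t, y) = 0.
  by move=> yx; rewrite -[LHS]mul1r -ux1 -uD eq_sym (negbTE yx) mul0r.
have uM h t : u ((h * t)%g, x) = u (h, x) * u (t, x).
  by rewrite -uD eqxx mul1r.
have uX g k : u ((g ^+ k)%g, x) = u (g, x) ^+ k.
  by elim: k => [|k IHk]; rewrite ?expr0 // expgS exprS uM IHk.
have u_root g : u (g, x) ^+ n.+1 = 1.
  rewrite -uX; have /dvdnP[k ->] := dvd_gT.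
  by rewrite mulnC expgM -cardsT expg_cardG ?inE // expg1n.
(* The values are [n.+1]-th roots of unity because the group order divides [n.+1], so each is a
   power of [z]. *)
pose chi g : 'I_n.+1 := sval (prim_rootP z_prim (u_root g)).
have chiE g : u (g, x) = z ^+ chi g by rewrite /chi; case: prim_rootP.
have chiM : {morph chi : g h / (g * h)%g}.
  by move=> g h; apply: prim_root_inj; rewrite prim_root_mul -!chiE uM.
exists (mk_dual chiM, x); apply/ffunP => -[g y]; rewrite ffunE /= mk_dualE.
by have [->|/u_out->] := eqVneq y x; rewrite ?mul0r // mul1r chiE.
Qed.

End OneGroup.

Section Isomorphism.

Variables gT hT : finGroupType.
Hypotheses (dvd_gT : (#|gT| %| n.+1)%N) (dvd_hT : (#|hT| %| n.+1)%N).
Variable f : {linear coord_space C (gT * gT)%type ->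
                     coord_space C (hT * hT)%type}.
Hypotheses (f_bij : bijective f)
  (fH : hopf_morphism (drinfeld_double C gT) (drinfeld_double C hT) f).

Lemma tens_map_inj : injective (tens_map f f).
Proof.
have [g fK gK] := f_bij.
have g_lin : linear g.
  by move=> a u v; apply: (bij_inj f_bij); rewrite linearP !gK.
pose G : {linear _ -> _} := HB.pack g (GRing.isLinear.Build C _ _ _ g g_lin).
apply: (can_inj (g := tens_map G G)); apply: eq_on_basis => // [|[i j]].
  by move=> a u v; rewrite /tens_map !lin_ext_linear.
by rewrite -tens_basis !tens_map_tens /= !fK.
Qed.

Lemma double_iso_grouplike :
  group_iso (dual n gT * gT)%type (dual n hT * hT)%type.
Proof.
have [[_ fM] [fD f1] _] := fH.
have im p : exists p', f (grouplike p) = grouplike p'.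
  apply: grouplikeP => //; last by rewrite f1 grouplike_counit.
  by rewrite fD grouplike_comul tens_map_tens.
(* The inverse image of a group-like is group-like: compare coproducts after applying the injective
   map [tens_map f f]. *)
have preim p' : exists p, f (grouplike p) = grouplike p'.
  have [g fK gK] := f_bij.
  have [//|||p eq_p] := @grouplikeP gT _ (g (grouplike p')).
  - by apply: tens_map_inj; rewrite -fD tens_map_tens gK grouplike_comul.
  - by rewrite -f1 gK grouplike_counit.
  by exists p; rewrite -eq_p gK.
have [F imF] := fin_all_exists im; have [F' imF'] := fin_all_exists preim.
exists F.
  exists F' => p; last by apply: grouplike_inj; rewrite -imF imF'.
  by apply/grouplike_inj/(bij_inj f_bij); rewrite imF' imF.
by move=> p q; apply: grouplike_inj; rewrite -imF !grouplike_mul fM !imF.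
Qed.

End Isomorphism.

End GroupLike.

Lemma group_iso_isog (gT hT : finGroupType) :
  group_iso gT hT -> [set: gT] \isog [set: hT].
Proof.
move=> [f [g fK gK] fM].
have fM' : {in [set: gT] &, {morph f : x y / (x * y)%g}} by move=> x y _ _.
apply/isogP; exists (Morphism fM').
  by apply/injmP => x y _ _ /=; apply: (can_inj fK).
apply/setP => y; rewrite inE; apply/morphimP.
by exists (g y); rewrite ?inE //= gK.
Qed.

Theorem corollary12p2 (R : realType) (gT hT : finGroupType)
  (omega : gT -> gT -> gT -> R[i]) (eta : hT -> hT -> hT -> R[i])
  (omega_cocycle : normalized_3cocycle omega)
  (eta_cocycle : normalized_3cocycle eta) :
  ((exists f : {linear coord_space R[i] (gT * gT)%type ->
                       coord_space R[i] (hT * hT)%type},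
      rigid_isomorphism omega eta f) ->
    [set: gT] \isog [set: hT]) /\
  (forall f : {linear coord_space R[i] (gT * gT)%type ->
                       coord_space R[i] (hT * hT)%type},
      rigid_isomorphism omega eta f ->
      quasi_hopf_morphism (twisted_double omega) (twisted_double eta) f).
Proof.
have neq0 (kT : finGroupType) (v : kT -> kT -> kT -> R[i]) :
    normalized_3cocycle v -> forall a b c, v a b c != 0.
  by move=> [v1 _ _] a b c; rewrite -normr_gt0 v1 ltr01.
split=> [[f [f_bij _ fH]]|f [f_bij fQ fH]].
  (* One exponent divisible by both group orders, so that the same roots of unity serve the
     characters of both groups. *)
  have [n defN] : exists n, (#|gT| * #|hT|)%N = n.+1.
    exists (#|gT| * #|hT|).-1; rewrite prednK // muln_gt0.
    by apply/andP; split; apply/card_gt0P; exists 1%g.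
  have [z z_prim] := @prim_root_exists R[i] n.+1 isT.
  apply/group_iso_isog/(@group_iso_cancel_dual n).
  apply: (double_iso_grouplike z_prim _ _ f_bij fH); rewrite -defN.
    exact: dvdn_mulr.
  exact: dvdn_mull.
have w0 := neq0 _ _ omega_cocycle; have e0 := neq0 _ _ eta_cocycle.
split=> //; first exact: rigid_antipode.
  (* By definition [qh_alpha] is the same sum as [qh_one]. *)
  by have [[f1 _] _ _] := fQ.
exact: rigid_beta.
Qed.
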